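(* Let $X$ be a set, and identify the free Novikov dialgebra $\mathrm{di\text{-}Nov}\langle X\rangle$ with the subspace of $\mathrm{DerPerm}\langle X\rangle$ obtained from $X$ by the operations $x_1\vdash x_2=x_1d(x_2)$ and $x_1\dashv x_2=d(x_2)x_1$. Then every element of the free Novikov dialgebra can be written in a unique way as a sum of elements of $\mathrm{DerPerm}_{\succ}\langle X\rangle$ and $\mathrm{DerPerm}_{\prec}\langle X\rangle$; that is, $$\mathrm{di\text{-}Nov}\langle X\rangle=\mathrm{DerPerm}_{\succ}\langle X\rangle\oplus\mathrm{DerPerm}_{\prec}\langle X\rangle$$ as a vector space.
   Context: All algebras are over a fixed field. A perm algebra is an associative (not necessarily unital) algebra satisfying the left-commutative identity $abc=bac$. $\mathrm{DerPerm}\langle X\rangle$ is the free perm algebra with a derivation $d$ generated by the set $X$; as a perm algebra it is the free perm algebra on the symbols $x^{(k)}=d^k(x)$, $x\in X$, $k\ge 0$. $\mathrm{DerPerm}_{\succ}\langle X\rangle$ (respectively $\mathrm{DerPerm}_{\prec}\langle X\rangle$) is the subalgebra generated by $X$ of the space $\mathrm{DerPerm}\langle X\rangle$ equipped with the single operation $a\succ b=d(a)b$ (respectively $a\prec b=a\,d(b)$). A Novikov dialgebra is a vector space with two bilinear operations $\vdash,\dashv$ satisfying $(x_1\dashv x_2)\vdash x_3=(x_1\vdash x_2)\vdash x_3$, $x_1\dashv(x_2\vdash x_3)=x_1\dashv(x_2\dashv x_3)$, $(x_1\vdash x_2)\vdash x_3-x_1\vdash(x_2\vdash x_3)=(x_2\vdash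 x_1)\vdash x_3-x_2\vdash(x_1\vdash x_3)$, $(x_1\dashv x_2)\dashv x_3=(x_1\dashv x_3)\dashv x_2$, $(x_1\dashv x_2)\dashv x_3-x_1\dashv(x_2\dashv x_3)=(x_2\vdash x_1)\dashv x_3-x_2\vdash(x_1\dashv x_3)$, $(x_1\vdash x_2)\dashv x_3=(x_1\vdash x_3)\vdash x_2$. $\mathrm{di\text{-}Nov}\langle X\rangle$ is the free Novikov dialgebra on $X$. Every perm algebra with derivation is a Novikov dialgebra under $x_1\vdash x_2=x_1d(x_2)$, $x_1\dashv x_2=d(x_2)x_1$, and it is known that every Novikov dialgebra embeds into a perm algebra with derivation in this way; hence the homomorphism $\mathrm{di\text{-}Nov}\langle X\rangle\to\mathrm{DerPerm}\langle X\rangle$ extending the identity on $X$ is injective, which gives the identification used in the claim. Under it, $a\succ b=b\dashv a$ and $a\prec b=a\vdash b$.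
   Formalization: Both subalgebras contain X, so the sum is not direct in degree 1 if X is nonempty. Proved instead: di-Nov⟨X⟩ is the sum of the two, they intersect exactly in kX, and each element is uniquely a sum from kX, the span of ≻-products and the span of ≺-products. *)

(* Defs.v *)
From HB Require Import structures.
From mathcomp Require Import all_boot all_algebra.

Set Implicit Arguments.
Unset Strict Implicit.
Unset Printing Implicit Defensive.

Import GRing.Theory.
Local Open Scope ring_scope.

(* Perm algebras with a derivation; the product need not have a unit. *)
Record derPerm (K : fieldType) := DerPerm {
  dp_sort :> lmodType K;
  dp_mul : {bilinear dp_sort -> dp_sort -> dp_sort};
  dp_d : {linear dp_sort -> dp_sort};
  dp_mulA : forall a b c, dp_mul (dp_mul a b) c = dp_mul a (dp_mul b c);
  dp_mulCl : forall a b c, dp_mul (dp_mul a b) c = dp_mul (dp_mul b a) c;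
  dp_dM : forall a b, dp_d (dp_mul a b) = dp_mul (dp_d a) b + dp_mul a (dp_d b)
}.

Definition derPerm_hom (K : fieldType) (P Q : derPerm K)
    (f : {linear P -> Q}) : Prop :=
  (forall a b, f (dp_mul P a b) = dp_mul Q (f a) (f b)) /\
  (forall a, f (dp_d P a) = dp_d Q (f a)).

(* [free_derPerm x]: P, with x : X -> P, is DerPerm<X>. *)
Definition free_derPerm (K : fieldType) (X : Type) (P : derPerm K)
    (x : X -> P) : Prop :=
  forall (Q : derPerm K) (g : X -> Q),
  exists f : {linear P -> Q},
    [/\ derPerm_hom f,
        forall i, f (x i) = g i
      & forall f' : {linear P -> Q},
          derPerm_hom f' -> (forall i, f' (x i) = g i) -> f' =1 f].

(* nd_l is |- and nd_r is -|. *)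
Record novDialg (K : fieldType) := NovDialg {
  nd_sort :> lmodType K;
  nd_l : {bilinear nd_sort -> nd_sort -> nd_sort};
  nd_r : {bilinear nd_sort -> nd_sort -> nd_sort};
  nd_ax1 : forall x1 x2 x3, nd_l (nd_r x1 x2) x3 = nd_l (nd_l x1 x2) x3;
  nd_ax2 : forall x1 x2 x3, nd_r x1 (nd_l x2 x3) = nd_r x1 (nd_r x2 x3);
  nd_ax3 : forall x1 x2 x3,
    nd_l (nd_l x1 x2) x3 - nd_l x1 (nd_l x2 x3) =
    nd_l (nd_l x2 x1) x3 - nd_l x2 (nd_l x1 x3);
  nd_ax4 : forall x1 x2 x3, nd_r (nd_r x1 x2) x3 = nd_r (nd_r x1 x3) x2;
  nd_ax5 : forall x1 x2 x3,
    nd_r (nd_r x1 x2) x3 - nd_r x1 (nd_r x2 x3) =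
    nd_r (nd_l x2 x1) x3 - nd_l x2 (nd_r x1 x3);
  nd_ax6 : forall x1 x2 x3, nd_r (nd_l x1 x2) x3 = nd_l (nd_l x1 x3) x2
}.

Definition novDialg_hom (K : fieldType) (M N : novDialg K)
    (f : {linear M -> N}) : Prop :=
  (forall a b, f (nd_l M a b) = nd_l N (f a) (f b)) /\
  (forall a b, f (nd_r M a b) = nd_r N (f a) (f b)).

(* [free_novDialg y]: N, with y : X -> N, is di-Nov<X>. *)
Definition free_novDialg (K : fieldType) (X : Type) (N : novDialg K)
    (y : X -> N) : Prop :=
  forall (M : novDialg K) (g : X -> M),
  exists f : {linear N -> M},
    [/\ novDialg_hom f,
        forall i, f (y i) = g i
      & forall f' : {linear N -> M},
          novDialg_hom f' -> (forall i, f' (y i) = g i) -> f' =1 f].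

Section DerivedOperations.
Variables (K : fieldType) (P : derPerm K).
Implicit Types a b c : P.

Local Notation "a '.*' b" := (dp_mul P a b) (at level 40, left associativity).
Local Notation d := (dp_d P).

Definition dp_succ a b : P := d a .* b.
Definition dp_prec a b : P := a .* d b.

(* P is a Novikov dialgebra with |- := dp_prec and a -| b := dp_succ b a. *)
Definition dp_r a b : P := dp_succ b a.

Lemma dp_prec_bilinear : bilinear_for *:%R *:%R dp_prec.
Proof.
split=> u k a b; rewrite /dp_prec.
  exact: linearPl.
by rewrite linearP; exact: linearPr.
Qed.

Lemma dp_r_bilinear : bilinear_for *:%R *:%R dp_r.
Proof.
split=> u k a b; rewrite /dp_r /dp_succ.
  exact: linearPr.
by rewrite linearP; exact: linearPl.
Qed.

HB.instance Definition _ :=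
  bilinear_isBilinear.Build K P P P *:%R *:%R dp_prec dp_prec_bilinear.
HB.instance Definition _ :=
  bilinear_isBilinear.Build K P P P *:%R *:%R dp_r dp_r_bilinear.

Lemma dp_ax1 a b c : dp_prec (dp_r a b) c = dp_prec (dp_prec a b) c.
Proof. exact: dp_mulCl. Qed.

Lemma dp_ax2 a b c : dp_r a (dp_prec b c) = dp_r a (dp_r b c).
Proof.
rewrite /dp_r /dp_succ /dp_prec !dp_dM !linearDl /= addrC.
by rewrite dp_mulCl [d b .* d c .* a]dp_mulCl.
Qed.

Lemma dp_ax3 a b c :
  dp_prec (dp_prec a b) c - dp_prec a (dp_prec b c) = dp_prec (dp_prec b a) c - dp_prec b (dp_prec a c).
Proof.
rewrite /dp_prec !dp_dM !linearDr /= -!dp_mulA !opprD !addrA !subrr !add0r.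
by rewrite dp_mulCl.
Qed.

Lemma dp_ax4 a b c : dp_r (dp_r a b) c = dp_r (dp_r a c) b.
Proof. by rewrite /dp_r /dp_succ -!dp_mulA dp_mulCl. Qed.

Lemma dp_ax5 a b c :
  dp_r (dp_r a b) c - dp_r a (dp_r b c) = dp_r (dp_prec b a) c - dp_prec b (dp_r a c).
Proof.
rewrite /dp_prec /dp_r /dp_succ !dp_dM linearDl linearDr /= -!dp_mulA.
rewrite [d c .* b .* d a]dp_mulCl [d (d c) .* b .* a]dp_mulCl.
by rewrite opprD addrCA subrr addr0 opprD addrCA subrr addr0.
Qed.

Lemma dp_ax6 a b c : dp_r (dp_prec a b) c = dp_prec (dp_prec a c) b.
Proof. by rewrite /dp_r /dp_succ /dp_prec -!dp_mulA dp_mulCl. Qed.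

Definition dp_nov : novDialg K :=
  @NovDialg K P dp_prec dp_r dp_ax1 dp_ax2 dp_ax3 dp_ax4 dp_ax5 dp_ax6.

End DerivedOperations.

Section Subspaces.
Variables (K : fieldType) (V : lmodType K).

Inductive lin_span (S : V -> Prop) : V -> Prop :=
| LinSpan0 : lin_span S 0
| LinSpanP (k : K) u v : S u -> lin_span S v -> lin_span S (k *: u + v).

Variable op : V -> V -> V.

(* The subalgebra of (V, op) generated by the family x. *)
Inductive gen_subalg (X : Type) (x : X -> V) : V -> Prop :=
| GenSub0 : gen_subalg x 0
| GenSubX i : gen_subalg x (x i)
| GenSubP (k : K) u v :
    gen_subalg x u -> gen_subalg x v -> gen_subalg x (k *: u + v)
| GenSubM u v : gen_subalg x u -> gen_subalg x v -> gen_subalg x (op u v).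

(* The span of the products of two elements of S. *)
Definition square (S : V -> Prop) : V -> Prop :=
  lin_span (fun v => exists a b, [/\ S a, S b & v = op a b]).

End Subspaces.

Section Components.
Variables (K : fieldType) (X : Type) (P : derPerm K) (x : X -> P).

Definition DerPerm_succ : P -> Prop := gen_subalg (@dp_succ K P) x.
Definition DerPerm_prec : P -> Prop := gen_subalg (@dp_prec K P) x.

(* Both subalgebras contain kX, so the sum can only be direct apart from this
   common part of degree 1.  A subalgebra generated by X is the sum of kX and
   its square; the squares of DerPerm_succ and DerPerm_prec are their parts of
   degree at least 2. *)
Definition lin_part : P -> Prop := lin_span (fun v => exists i, v = x i).
Definition DerPerm_succ2 : P -> Prop := square (@dp_succ K P) DerPerm_succ.
Definition DerPerm_prec2 : P -> Prop := square (@dp_prec K P) DerPerm_prec.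

End Components.

(* Main.v *)
Require Import Defs.
From HB Require Import structures.
From mathcomp Require Import all_boot all_algebra.
From mathcomp Require Import boolp.

Set Implicit Arguments.
Unset Strict Implicit.
Unset Printing Implicit Defensive.

Import GRing.Theory.
Local Open Scope ring_scope.

(** The picture behind the proof is that a free perm algebra has a basis of
    words u * z in which the letters of u commute and the last letter z is
    distinguished.  For two factors or more, a product [d a * b] built from the
    generators always ends in an underived generator, while a product
    [a * d b] always ends in a derived one.  This makes the sum direct, and it
    remains to see that the sum is closed under both operations.

    No basis is needed.  The universal property produces linear endomorphisms
    of [P] that commute with left multiplications, one for each choice of
    images of the generators and each connection, that is, each linear [D]
    with [D (a * b) = d a * b + a * D b] ([left_linear_extension]).
    One of them, [delta], derives the last letter; the difference [d - delta] is then a connection for which the generators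
    are flat, and the endomorphism [pi] that it yields keeps the words ending
    in a generator and kills those ending in a proper derivative.  Thus [pi]
    fixes [DerPerm_succ] and vanishes on [DerPerm_prec2]
    ([succ_projection]).  A similar map isolates degree 1, and the three
    summands are independent ([succ_prec_independent]).

    For closure, left-commutativity makes left multiplications commute, so the
    left multiplication by [d a * b] is also that by [b * d a].  Hence a left
    factor taken from one of the two subalgebras can be exchanged for one from
    the other ([succ_same_left_prec], [prec_same_left_succ]), and an induction
    on the right factor shows that the sum of the subalgebras is closed
    ([succ_plus_prec_succ], [succ_plus_prec_prec]).  The free Novikov
    dialgebra has an induction principle ([free_novDialg_ind]), by which
    its image in [P] lies in that sum. *)

(** * Induction on a free Novikov dialgebra *)

Section FreeNovInduction.
Variables (K : fieldType) (X : Type) (N : novDialg K) (y : X -> N).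
Variable S : N -> Prop.
Hypothesis S_y : forall i, S (y i).
Hypothesis S_0 : S 0.
Hypothesis S_lin : forall (k : K) u v, S u -> S v -> S (k *: u + v).
Hypothesis S_l : forall u v, S u -> S v -> S (nd_l N u v).
Hypothesis S_r : forall u v, S u -> S v -> S (nd_r N u v).

(** The predicate is made boolean by classical logic, so that the elements
    satisfying it form a subtype with decidable equality and choice, as an
    [lmodType] requires. *)
Definition sub_pred : {pred N} := fun v => `[< S v >].

Fact sub_pred_submod : submod_closed sub_pred.
Proof.
split; first exact/asboolP.
by move=> k u v /asboolP Su /asboolP Sv; apply/asboolP; exact: S_lin.
Qed.

HB.instance Definition _ :=
  GRing.isSubmodClosed.Build K N sub_pred sub_pred_submod.

Record sub_nov := SubNov { sub_val : N; sub_valP : sub_val \in sub_pred }.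

HB.instance Definition _ := [isSub for sub_val].
HB.instance Definition _ := [Choice of sub_nov by <:].
HB.instance Definition _ := [SubChoice_isSubLmodule of sub_nov by <:].

Fact sub_val_sat (u : sub_nov) : S (val u).
Proof. exact: asboolW (sub_valP u). Qed.

Fact sub_l_subproof (u v : sub_nov) : nd_l N (val u) (val v) \in sub_pred.
Proof. by apply: asboolT; apply: S_l; exact: sub_val_sat. Qed.
Fact sub_r_subproof (u v : sub_nov) : nd_r N (val u) (val v) \in sub_pred.
Proof. by apply: asboolT; apply: S_r; exact: sub_val_sat. Qed.

Definition sub_l u v := SubNov (sub_l_subproof u v).
Definition sub_r u v := SubNov (sub_r_subproof u v).

Fact sub_l_bilinear : bilinear_for *:%R *:%R sub_l.
Proof.
by split=> u k a b; apply: val_inj;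
   rewrite /= ?linearP /= ?linearPl ?linearPr ?linearP.
Qed.
Fact sub_r_bilinear : bilinear_for *:%R *:%R sub_r.
Proof.
by split=> u k a b; apply: val_inj;
   rewrite /= ?linearP /= ?linearPl ?linearPr ?linearP.
Qed.

HB.instance Definition _ :=
  bilinear_isBilinear.Build K sub_nov sub_nov sub_nov *:%R *:%R
    sub_l sub_l_bilinear.
HB.instance Definition _ :=
  bilinear_isBilinear.Build K sub_nov sub_nov sub_nov *:%R *:%R
    sub_r sub_r_bilinear.

Definition sub_novDialg : novDialg K.
Proof.
refine (@NovDialg K sub_nov sub_l sub_r _ _ _ _ _ _) => a b c;
  apply: val_inj; rewrite ?raddfB /=.
- exact: nd_ax1.
- exact: nd_ax2.
- exact: nd_ax3.
- exact: nd_ax4.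
- exact: nd_ax5.
- exact: nd_ax6.
Defined.

(** The subspace cut out by [S] is itself a Novikov dialgebra, so the
    generators extend to a homomorphism into it.  Followed by the inclusion,
    this is an endomorphism fixing the generators, hence the identity. *)
Lemma free_novDialg_ind : free_novDialg y -> forall f, S f.
Proof.
move=> free_N f.
have Sy i : y i \in sub_pred by apply/asboolP.
have [h [[hl hr] hy _]] := free_N sub_novDialg (fun i => SubNov (Sy i)).
have [g [_ _ g_uniq]] := free_N N y.
have idg := g_uniq idfun (conj (fun _ _ => erefl) (fun _ _ => erefl))
  (fun _ => erefl).
pose val_h : {linear N -> N} := (val : sub_nov -> N) \o h.
have val_hg : val_h =1 g.
  apply: g_uniq => [|i]; last by rewrite /= hy.
  by split=> a b; rewrite /= ?hl ?hr.
have -> : f = val (h f : sub_nov) by rewrite -[LHS]/(idfun f) idg -val_hg.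
exact: sub_val_sat.
Qed.

End FreeNovInduction.

(** * Maps from a free perm algebra with derivation to a module *)

Section ModuleExtension.
Variables (K : fieldType) (P : derPerm K) (M : lmodType K).
Variables (act : {bilinear P -> M -> M}) (dM : {linear M -> M}).
Hypothesis actA : forall a b m, act (dp_mul P a b) m = act a (act b m).
Hypothesis actC : forall a b m, act a (act b m) = act b (act a m).
Hypothesis act_d : forall a m, dM (act a m) = act (dp_d P a) m + act a (dM m).

(** The square-zero extension of [P] by [M] in which [P] acts on [M] from the
    left only. *)
Definition ext_mul (u v : P * M) : P * M := (dp_mul P u.1 v.1, act u.1 v.2).
Definition ext_d (u : P * M) : P * M := (dp_d P u.1, dM u.2).

Fact ext_mul_bilinear : bilinear_for *:%R *:%R ext_mul.
Proof.
by split=> u k a b; rewrite /ext_mul /=; congr (_, _);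
   rewrite ?linearPl ?linearPr.
Qed.
Fact ext_d_linear : linear ext_d.
Proof. by move=> k u v; congr (_, _); exact: linearP. Qed.

HB.instance Definition _ :=
  bilinear_isBilinear.Build K (P * M)%type (P * M)%type (P * M)%type
    *:%R *:%R ext_mul ext_mul_bilinear.
HB.instance Definition _ :=
  GRing.isLinear.Build K (P * M)%type (P * M)%type *:%R ext_d ext_d_linear.

Definition ext_derPerm : derPerm K.
Proof.
refine (@DerPerm K (P * M)%type ext_mul ext_d _ _ _).
- by move=> a b c; congr (_, _); [exact: dp_mulA | exact: actA].
- by move=> a b c; congr (_, _); rewrite /= ?actA //; exact: dp_mulCl.
- by move=> a b; congr (_, _); [exact: dp_dM | exact: act_d].
Defined.

(** Such a map is the second component of a homomorphism to the extension; the
    first component is an endomorphism of [P] fixing the generators, hence the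
    identity. *)
Lemma free_derPerm_module (X : Type) (x : X -> P) (g : X -> M) :
    free_derPerm x ->
  exists f : {linear P -> M},
    [/\ forall i, f (x i) = g i,
        forall a b, f (dp_mul P a b) = act a (f b)
      & forall a, f (dp_d P a) = dM (f a)].
Proof.
move=> free_P.
have [h [[hM hd] hx _]] := free_P ext_derPerm (fun i => (x i, g i)).
have [e [_ _ e_uniq]] := free_P P x.
have ide := e_uniq idfun (conj (fun _ _ => erefl) (fun _ => erefl))
  (fun _ => erefl).
pose h1 : {linear P -> P} := (fst : P * M -> P) \o h.
have h1K a : (h a : P * M).1 = a.
  have h1e : h1 =1 e.
    apply: e_uniq => [|i]; last by rewrite /= hx.
    by split=> [b c|b]; rewrite /= ?hM ?hd.
  by rewrite -[RHS]/(idfun a) ide -h1e.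
exists ((snd : P * M -> M) \o h); split=> [i|a b|a] /=.
- by rewrite hx.
- by rewrite hM /= h1K.
- by rewrite hd.
Qed.

End ModuleExtension.

(** * Spans and generated subalgebras *)

Section Subspaces.
Variables (K : fieldType) (V : lmodType K).

Section Span.
Variable S : V -> Prop.

Lemma lin_span_gen v : S v -> lin_span S v.
Proof.
move=> Sv; rewrite -[v]addr0 -[v]scale1r.
by apply: LinSpanP => //; exact: LinSpan0.
Qed.

Lemma lin_spanP (k : K) u v :
  lin_span S u -> lin_span S v -> lin_span S (k *: u + v).
Proof.
move=> Su Sv; elim: Su => [|l a b Sa _ IH]; first by rewrite scaler0 add0r.
by rewrite scalerDr scalerA -addrA; exact: LinSpanP.
Qed.

Lemma lin_spanD u v : lin_span S u -> lin_span S v -> lin_span S (u + v).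
Proof. by move=> Su; rewrite -[u]scale1r; exact: lin_spanP. Qed.

Lemma linear_on_span (W : lmodType K) (f g : {linear V -> W}) :
  (forall v, S v -> f v = g v) -> forall v, lin_span S v -> f v = g v.
Proof.
move=> fg v; elim=> [|k a b Sa _ IH]; first by rewrite !linear0.
by rewrite !linearP IH fg.
Qed.

End Span.

Section Subalgebra.
Variables (op : V -> V -> V) (X : Type) (x : X -> V).

Lemma gen_subalgD u v :
  gen_subalg op x u -> gen_subalg op x v -> gen_subalg op x (u + v).
Proof. by move=> Gu; rewrite -[u]scale1r; exact: GenSubP. Qed.

Lemma gen_subalgB u v :
  gen_subalg op x u -> gen_subalg op x v -> gen_subalg op x (u - v).
Proof. by move=> Gu Gv; rewrite addrC -scaleN1r; exact: GenSubP. Qed.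

Lemma lin_span_gen_subalg v :
  lin_span (fun u => exists i, u = x i) v -> gen_subalg op x v.
Proof.
elim=> [|k u w [i ->] _]; first exact: GenSub0.
by apply: GenSubP; exact: GenSubX.
Qed.

Lemma square_gen_subalg v :
  square op (gen_subalg op x) v -> gen_subalg op x v.
Proof.
elim=> [|k u w [a [b [Ga Gb ->]]] _]; first exact: GenSub0.
by apply: GenSubP; exact: GenSubM.
Qed.

Lemma gen_subalg_split v : gen_subalg op x v ->
  exists l s, [/\ lin_span (fun u => exists i, u = x i) l,
                  square op (gen_subalg op x) s & v = l + s].
Proof.
elim=> [|i|k u w _ [l [s [Ll Ss ->]]] _ [l' [s' [Ll' Ss' ->]]]|u w Gu _ Gw _].
- by exists 0, 0; split; [exact: LinSpan0 | exact: LinSpan0 | rewrite addr0].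
- exists (x i), 0; split; [|exact: LinSpan0 | by rewrite addr0].
  by apply: lin_span_gen; exists i.
- exists (k *: l + l'), (k *: s + s'); split; try exact: lin_spanP.
  by rewrite scalerDr addrACA.
- exists 0, (op u w); split; [exact: LinSpan0 | | by rewrite add0r].
  by apply: lin_span_gen; exists u, w.
Qed.

End Subalgebra.
End Subspaces.

(** * Independence of the three summands *)

Section Projections.
Variables (K : fieldType) (X : Type) (P : derPerm K) (x : X -> P).
Hypothesis free_P : free_derPerm x.

Local Notation "a '.*' b" := (dp_mul P a b) (at level 40, left associativity).
Local Notation d := (dp_d P).

Lemma left_linear_extension (D : {linear P -> P}) (g : X -> P) :
    (forall a b, D (a .* b) = d a .* b + a .* D b) ->
  exists f : {linear P -> P},
    [/\ forall i, f (x i) = g i, forall a b, f (a .* b) = a .* f b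
      & forall a, f (d a) = D (f a)].
Proof.
move=> D_conn; apply: (free_derPerm_module (act := dp_mul P)) => //.
- exact: dp_mulA.
- by move=> a b m; rewrite -!dp_mulA dp_mulCl.
Qed.

(** In terms of words, [pi] keeps those ending in an underived generator and
    kills the others. *)
Lemma succ_projection : exists pi : {linear P -> P},
  (forall s, DerPerm_succ x s -> pi s = s) /\
  (forall p, DerPerm_prec2 x p -> pi p = 0).
Proof.
(* delta derives only the last letter of a word, D all the letters but it. *)
have [delta [delta_x deltaM delta_d]] :=
  left_linear_extension (fun i => d (x i)) (dp_dM (d := P)).
pose D : {linear P -> P} := d \- delta.
have DM a b : D (a .* b) = d a .* b + a .* D b.
  by rewrite /= dp_dM deltaM linearBr addrA.
have [pi [pi_x piM pi_d]] := left_linear_extension x DM.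
have D_x i : D (x i) = 0 by rewrite /= delta_x subrr.
(* pi (a * d b) = a * D (pi b), and pi b is a combination of generators when b
   is in DerPerm_prec. *)
have D_pi p : DerPerm_prec x p -> D (pi p) = 0.
  elim=> [|i|k u v _ IHu _ IHv|u v _ _ _ IHv].
  - by rewrite !linear0.
  - by rewrite pi_x D_x.
  - by rewrite !linearP IHu IHv scaler0 addr0.
  - by rewrite piM pi_d IHv linear0r linear0.
exists pi; split=> [s | p].
  elim=> [|i|k u v _ IHu _ IHv|u v _ _ _ IHv].
  - exact: linear0.
  - exact: pi_x.
  - by rewrite linearP IHu IHv.
  - by rewrite piM IHv.
apply: (linear_on_span (g := \0)) => _ [a [b [_ Pb ->]]].
by rewrite piM pi_d D_pi // linear0r.
Qed.

(** The module is [P] with zero action and zero connection: every product goes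
    to zero. *)
Lemma degree1_projection : exists lambda : {linear P -> P},
  (forall l, lin_part x l -> lambda l = l) /\
  (forall a b, lambda (a .* b) = 0).
Proof.
have zero_bilinear : bilinear_for *:%R *:%R (fun _ _ : P => 0 : P).
  by split=> u k a b; rewrite addr0 /= scaler0.
pose zero_act : {bilinear P -> P -> P} :=
  HB.pack (fun _ _ : P => 0 : P)
    (bilinear_isBilinear.Build K P P P *:%R *:%R _ zero_bilinear).
have [|||lambda [lambda_x lambdaM _]] :=
  free_derPerm_module (act := zero_act) (dM := \0) _ _ _ x free_P.
- by [].
- by [].
- by move=> a m /=; rewrite addr0.
exists lambda; split=> [|a b]; last exact: lambdaM.
by apply: (linear_on_span (g := idfun)) => _ [i ->]; exact: lambda_x.
Qed.

Lemma succ_prec_independent l s p :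
    lin_part x l -> DerPerm_succ2 x s -> DerPerm_prec2 x p ->
  l + s + p = 0 -> [/\ l = 0, s = 0 & p = 0].
Proof.
move=> Ll Ss Pp lsp0.
have [pi [pi_s pi_p]] := succ_projection.
have [lambda [lambda_l lambdaM]] := degree1_projection.
have lambda_s : lambda s = 0.
  apply: (linear_on_span (g := \0)) Ss => _ [a [b [_ _ ->]]]; exact: lambdaM.
have ls0 : l + s = 0.
  have Sls : DerPerm_succ x (l + s).
    by apply: gen_subalgD;
       [exact: lin_span_gen_subalg | exact: square_gen_subalg].
  have := congr1 pi lsp0.
  by rewrite linearD (pi_s _ Sls) (pi_p _ Pp) addr0 linear0.
have l0 : l = 0.
  have := congr1 lambda ls0.
  by rewrite linearD (lambda_l _ Ll) lambda_s addr0 linear0.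
have s0 : s = 0 by rewrite -ls0 l0 add0r.
by split=> //; rewrite -lsp0 l0 s0 !add0r.
Qed.

End Projections.

(** * Closure of the sum of the two subalgebras *)

Section Closure.
Variables (K : fieldType) (X : Type) (P : derPerm K) (x : X -> P).

Local Notation "a '.*' b" := (dp_mul P a b) (at level 40, left associativity).
Local Notation d := (dp_d P).
Local Notation Succ := (DerPerm_succ x).
Local Notation Prec := (DerPerm_prec x).
Implicit Types a b c : P.

(** Equality of [a] and [b] as left multiplications: in the free case, after
    forgetting which letter is the last. *)
Definition same_left a b := forall c, a .* c = b .* c.

(** Left multiplication by [d a] is the commutator of [d] with left
    multiplication by [a]. *)
Lemma same_left_d a b : same_left a b -> same_left (d a) (d b).
Proof.
by move=> ab c; apply: (addIr (a .* d c)); rewrite -dp_dM !ab dp_dM.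
Qed.

Lemma same_left_succ_prec a a' b b' :
  same_left a a' -> same_left b b' -> same_left (dp_succ a b) (dp_prec b' a').
Proof.
move=> aa' bb' c; rewrite /dp_succ /dp_prec dp_mulCl !dp_mulA bb'.
by rewrite (same_left_d aa').
Qed.

Lemma same_leftP k a a' b b' :
  same_left a a' -> same_left b b' -> same_left (k *: a + b) (k *: a' + b').
Proof. by move=> aa' bb' c; rewrite !linearPl /= aa' bb'. Qed.

Lemma succ_same_left_prec a :
  Succ a -> exists2 a', Prec a' & same_left a a'.
Proof.
elim=> [|i|k u v _ [u' Pu uu'] _ [v' Pv vv']|u v _ [u' Pu uu'] _ [v' Pv vv']].
- by exists 0; first exact: GenSub0.
- by exists (x i); first exact: GenSubX.
- by exists (k *: u' + v'); [exact: GenSubP | exact: same_leftP].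
- by exists (dp_prec v' u'); [exact: GenSubM | exact: same_left_succ_prec].
Qed.

Lemma prec_same_left_succ a :
  Prec a -> exists2 a', Succ a' & same_left a a'.
Proof.
elim=> [|i|k u v _ [u' Pu uu'] _ [v' Pv vv']|u v _ [u' Pu uu'] _ [v' Pv vv']].
- by exists 0; first exact: GenSub0.
- by exists (x i); first exact: GenSubX.
- by exists (k *: u' + v'); [exact: GenSubP | exact: same_leftP].
- exists (dp_succ v' u'); first exact: GenSubM.
  have sl : same_left (dp_succ v' u') (dp_prec u v).
    by apply: same_left_succ_prec => c; rewrite ?uu' ?vv'.
  by move=> c; rewrite sl.
Qed.

(** The term that is not visibly a product when [a * d (d b * c)] is expanded:
    it is what is left of [d (d b * a) * c] after removing
    [d b * (d a * c)]. *)
Lemma succ_act_d2 a b c : Succ a -> Succ b -> Succ c ->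
  Succ (a .* (d (d b) .* c)).
Proof.
move=> Sa Sb Sc.
have -> : a .* (d (d b) .* c) =
    dp_succ (dp_succ b a) c - dp_succ b (dp_succ a c).
  by rewrite /dp_succ dp_dM linearDl /= !dp_mulA addrK -!dp_mulA dp_mulCl.
by apply: gen_subalgB; do ?apply: GenSubM.
Qed.

Definition succ_plus_prec v := exists s p, [/\ Succ s, Prec p & v = s + p].

Lemma succ_plus_prec_lin k u v :
  succ_plus_prec u -> succ_plus_prec v -> succ_plus_prec (k *: u + v).
Proof.
move=> [s [p [Ss Pp ->]]] [s' [p' [Ss' Pp' ->]]].
exists (k *: s + s'), (k *: p + p'); split; try exact: GenSubP.
by rewrite scalerDr addrACA.
Qed.

Lemma succ_plus_precS s : Succ s -> succ_plus_prec s.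
Proof.
by move=> Ss; exists s, 0; split; [| exact: GenSub0 | rewrite addr0].
Qed.

Lemma succ_plus_precP p : Prec p -> succ_plus_prec p.
Proof.
by move=> Pp; exists 0, p; split; [exact: GenSub0 | | rewrite add0r].
Qed.

Lemma succ_plus_precD u v :
  succ_plus_prec u -> succ_plus_prec v -> succ_plus_prec (u + v).
Proof. by move=> Tu; rewrite -[u]scale1r; exact: succ_plus_prec_lin. Qed.

(** An element of the sum may be replaced, as a left factor, by one from
    whichever subalgebra suits the right factor. *)
Lemma succ_plus_prec_left a : succ_plus_prec a ->
  (exists2 a', Succ a' & same_left a a') /\
  (exists2 a', Prec a' & same_left a a').
Proof.
move=> [s [p [Ss Pp ->]]].
have [s' Ps' ss'] := succ_same_left_prec Ss.
have [p' Sp' pp'] := prec_same_left_succ Pp.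
split; [exists (s + p') | exists (s' + p)]; try exact: gen_subalgD.
  by move=> c; rewrite !linearDl /= pp'.
by move=> c; rewrite !linearDl /= ss'.
Qed.

(** The right factor decides the subalgebra.  For [b] in [DerPerm_succ] take
    the left factor in [DerPerm_succ] too; for [b = u * d v] in [DerPerm_prec],
    [d a * (u * d v) = (u * d a) * d v]. *)
Lemma succ_plus_prec_succ a b :
  succ_plus_prec a -> succ_plus_prec b -> succ_plus_prec (dp_succ a b).
Proof.
move=> /succ_plus_prec_left [[a1 Sa1 aa1] [a2 Pa2 aa2]] [s [p [Ss Pp ->]]].
rewrite /dp_succ linearDr /=; apply: succ_plus_precD.
  by apply: succ_plus_precS; rewrite (same_left_d aa1); exact: GenSubM.
rewrite (same_left_d aa2) => {a a1 s aa1 aa2 Sa1 Ss}.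
elim: Pp => [|i|k u v _ IHu _ IHv|u v Pu _ Pv _].
- by rewrite linear0r; apply: succ_plus_precS; exact: GenSub0.
- have [a3 Sa3 aa3] := prec_same_left_succ Pa2.
  rewrite (same_left_d aa3); apply: succ_plus_precS.
  by apply: GenSubM => //; exact: GenSubX.
- by rewrite linearPr; exact: succ_plus_prec_lin.
- apply: succ_plus_precP; rewrite /dp_prec -dp_mulA dp_mulCl.
  by do 2!apply: GenSubM => //.
Qed.

(** Here the case to study is [b = d u * v] in [DerPerm_succ], where
    [a * d b = a * (d (d u) * v) + (d u * a) * d v] up to exchanging left
    factors.  The second term is treated by induction on [v] with the
    left factor [d u * a], hence the generality of the left factor. *)
Lemma succ_plus_prec_prec a b :
  succ_plus_prec a -> succ_plus_prec b -> succ_plus_prec (dp_prec a b).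
Proof.
move=> Ta [s [p [Ss Pp ->]]].
rewrite /dp_prec linearD linearDr /=; apply: succ_plus_precD; last first.
  have [_ [a' Pa' aa']] := succ_plus_prec_left Ta.
  by rewrite aa'; apply: succ_plus_precP; exact: GenSubM.
have [[a' Sa' ->] _] := succ_plus_prec_left Ta.
elim: Ss a' Sa' => {a Ta} [|i|k u v _ IHu _ IHv|u v Su _ Sv IHv] a Sa.
- by rewrite linear0 linear0r; apply: succ_plus_precS; exact: GenSub0.
- have [a' Pa' ->] := succ_same_left_prec Sa.
  by apply: succ_plus_precP; apply: GenSubM => //; exact: GenSubX.
- by rewrite linearP linearPr; apply: succ_plus_prec_lin; auto.
- rewrite /dp_succ dp_dM linearDr /=; apply: succ_plus_precD.
    by apply: succ_plus_precS; exact: succ_act_d2.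
  by rewrite -dp_mulA dp_mulCl; apply: IHv; exact: GenSubM.
Qed.

End Closure.

(** * The decomposition *)

Theorem theorem2 (K : fieldType) (X : Type)
    (P : derPerm K) (x : X -> P) (free_P : free_derPerm x)
    (N : novDialg K) (y : X -> N) (free_N : free_novDialg y)
    (phi : {linear N -> dp_nov P}) (phi_hom : novDialg_hom phi)
    (phi_X : forall i : X, phi (y i) = x i) :
  [/\ forall v : P,
        (exists f : N, phi f = v) <->
        (exists s p : P, [/\ DerPerm_succ x s, DerPerm_prec x p & v = s + p]),
      forall v : P, DerPerm_succ x v /\ DerPerm_prec x v <-> lin_part x v
    & forall f : N, exists! t : P * P * P,
        [/\ lin_part x t.1.1, DerPerm_succ2 x t.1.2, DerPerm_prec2 x t.2
          & (phi f : P) = t.1.1 + t.1.2 + t.2]].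
Proof.
have [phi_l phi_r] := phi_hom.
have image_sum f : succ_plus_prec x (phi f : P).
  apply: (free_novDialg_ind (S := fun g => succ_plus_prec x (phi g : P))
            _ _ _ _ _ free_N) => [i||k u v Tu Tv|u v Tu Tv|u v Tu Tv].
  - by rewrite phi_X; apply: succ_plus_precS; exact: GenSubX.
  - by rewrite linear0; apply: succ_plus_precS; exact: GenSub0.
  - by rewrite linearP; exact: succ_plus_prec_lin.
  - by rewrite phi_l; exact: succ_plus_prec_prec.
  - by rewrite phi_r; exact: succ_plus_prec_succ.
split=> [v | v | f].
- split=> [[f <-] | [s [p [Ss Pp ->]]]]; first exact: image_sum.
  have [f <-] : exists f : N, (phi f : P) = s.
    elim: Ss => [|i|k _ _ _ [f <-] _ [g <-]|_ _ _ [f <-] _ [g <-]].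
    + by exists 0; rewrite linear0.
    + by exists (y i).
    + by exists (k *: f + g); rewrite linearP.
    + by exists (nd_r N g f); rewrite phi_r.
  have [g <-] : exists g : N, (phi g : P) = p.
    elim: Pp => [|i|k _ _ _ [g <-] _ [h <-]|_ _ _ [g <-] _ [h <-]].
    + by exists 0; rewrite linear0.
    + by exists (y i).
    + by exists (k *: g + h); rewrite linearP.
    + by exists (nd_l N g h); rewrite phi_l.
  by exists (f + g); rewrite linearD.
- split=> [[Sv Pv] | Lv]; last by split; exact: lin_span_gen_subalg.
  have [pi [pi_s pi_p]] := succ_projection free_P.
  have [l [p [Ll Pp v_lp]]] := gen_subalg_split Pv.
  have Sl : DerPerm_succ x l by exact: lin_span_gen_subalg.
  by rewrite -(pi_s _ Sv) v_lp linearD (pi_s _ Sl) (pi_p _ Pp) addr0.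
have [s [p [Ss Pp ->]]] := image_sum f.
have [ls [s2 [Lls Ss2 ->]]] := gen_subalg_split Ss.
have [lp [p2 [Llp Pp2 ->]]] := gen_subalg_split Pp.
exists (ls + lp, s2, p2); split=> /=.
  by split=> //; [exact: lin_spanD | rewrite addrA (addrAC ls)].
(* The difference of two decompositions is a decomposition of 0. *)
case=> [[l' s'] p'] /= [Ll' Ss' Pp' eq_sum].
have [||||l0 s0 p0] := succ_prec_independent free_P
  (l := -1 *: l' + (ls + lp)) (s := -1 *: s' + s2) (p := -1 *: p' + p2).
- by apply: lin_spanP => //; exact: lin_spanD.
- exact: lin_spanP.
- exact: lin_spanP.
- rewrite (addrACA (_ *: l')) -scalerDr addrACA -scalerDr -eq_sum scaleN1r.
  by rewrite [X in - X + _]addrA (addrAC ls) addNr.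
by congr (_, _, _); apply/eqP; rewrite -subr_eq0 addrC -scaleN1r; apply/eqP.
Qed.
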